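(* Assume $r>0$. For $0\le n\le N$ and $m\ge1$ define $$\bar x^{[m]*}_n:=\sup\{x\in(0,K]:g(x)\ge\bar f^{[m]}_n(x)\},\qquad \bar D^{[m]}_n:=\{x\in(0,K]:g(x)\ge\bar f^{[m]}_n(x)\}.$$ Then $\bar D^{[m]}_n=(0,\bar x^{[m]*}_n]$, and $\bar x^{[m+1]*}_n\ge\bar x^{[m]*}_n$ for every $n,m$. If in addition $\pi_0\le\pi_1\le\dots\le\pi_{N-1}$, then $\bar x^{[m]*}_{n+1}\le\bar x^{[m]*}_n$ (for $0\le n<N$). Define, with $\min\emptyset:=\partial$, $$\sigma^*_m=\min\{\nu\in\{0,\dots,N\}:S_\nu\in\bar D^{[m]}_{N-\nu}\},\quad \sigma^*_i=\min\{\nu\in\{0,\dots,N\}:\nu>\sigma^*_{i+1},\ S_\nu\in\bar D^{[i]}_{N-\nu}\},\ i=m-1,\dots,1.$$ This schedule $(\sigma^*_m,\dots,\sigma^*_1)$ is optimal (attains the supremum) in $$\sup_{\vec\sigma\in\mathcal T^{[m]}_0}\mathrm E\Big[\sum_{i:\,\sigma_i\le N}\alpha^{\sigma_i}\mathbf 1_{\{\sigma_i\le\widetilde N\}}(K-S_{\sigma_i})^+\Big];$$ an exercise produces a payoff only on $\{\sigma^*_i\le\widetilde N\}$, and if the random maturity occurs before the next scheduled exercise all remaining rights expire.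
   Context: Let $r\ge0$, $\alpha:=(1+r)^{-1}$, and $\lambda>1$ with $\lambda^{-1}<1+r<\lambda$. Put $p:=\frac{(1+r)-\lambda^{-1}}{\lambda-\lambda^{-1}}$, $q:=1-p$ (both in $(0,1)$). Let $N$ be a finite horizon, $S_0>0$ a constant and $S_\nu=S_0\lambda^{\varepsilon_1+\dots+\varepsilon_\nu}$ ($0\le\nu\le N$), where under $\mathrm P$ the $\varepsilon_\nu$ are i.i.d. with $\mathrm P(\varepsilon_\nu=1)=p$, $\mathrm P(\varepsilon_\nu=-1)=q$; $(\mathcal F_\nu)_{\nu=0}^N$ is the natural filtration of $S$. Let $K>0$, $g(x):=(K-x)^+$ for $x>0$, and $(\mathcal A\varphi)(x):=\alpha[p\,\varphi(\lambda x)+q\,\varphi(\lambda^{-1}x)]$. Random maturity: $\widetilde N$ is a random variable with values in $\{0,\dots,N\}$, independent of the price process, with $\mathrm P(\widetilde N=N)>0$. The option is void from time $\widetilde N+1$ on. For $n=1,\dots,N$ put $\pi_{n-1}:=\mathrm P(\widetilde N\ge N-n+1\mid\widetilde N\ge N-n)$ and $\mathcal A_n\varphi:=\pi_{n-1}\mathcal A\varphi$. Define $\bar V^{[0]}_n\equiv0$, $\bar V^{[m]}_0=g$ ($m\ge1$), and for $1\le n\le N$, $m\ge1$, $$\bar V^{[m]}_n(x)=\max\{g(x)+(\mathcal A_n\bar V^{[m-1]}_{n-1})(x),\ (\mathcal A_n\bar V^{[m]}_{n-1})(x)\}.$$ Put $\Delta\bar V^{[m]}_n:=\bar V^{[m]}_n-\bar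 V^{[m-1]}_n$, $\bar f^{[m]}_n:=\mathcal A_n\Delta\bar V^{[m]}_{n-1}$ ($n\ge1$), $\bar f^{[m]}_0:=0$. Admissible exercise vectors: let $\partial:=+\infty$ denote non-exercise. $\mathcal T^{[m]}_0$ is the set of vectors $(\sigma_m,\dots,\sigma_1)$ of $(\mathcal F_\nu)$-stopping times (price filtration only) with values in $\{0,\dots,N\}\cup\{\partial\}$ such that, pathwise, for some $\ell\in\{0,\dots,m\}$ (possibly depending on $\omega$) the finite coordinates are exactly $\sigma_m,\dots,\sigma_{m-\ell+1}$, with $0\le\sigma_m<\sigma_{m-1}<\dots<\sigma_{m-\ell+1}\le N$, and the remaining coordinates equal $\partial$. *)

(* Defs.v *)
From mathcomp Require Import all_boot all_order all_algebra.
From mathcomp Require Import all_classical all_reals all_analysis.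

Set Implicit Arguments.
Unset Strict Implicit.
Unset Printing Implicit Defensive.

Import Order.TTheory GRing.Theory Num.Theory.
Import numFieldNormedType.Exports.

Local Open Scope classical_set_scope.
Local Open Scope ring_scope.

Section Probability.
Context d (T : measurableType d) (R : realType) (P : probability T R).

Definition cond_prob (A B : set T) : R := fine (P (A `&` B)) / fine (P B).

Definition mutually_independent (n : nat) (X : 'I_n -> T -> R) : Prop :=
  forall (J : {set 'I_n}) (B : 'I_n -> set R),
    (forall i, measurable (B i)) ->
    P (\bigcap_(i in [set` J]) X i @^-1` B i) =
      (\prod_(i in J) P (X i @^-1` B i))%E.

Definition independent_systems (F G : set (set T)) : Prop :=
  forall A B, F A -> G B -> P (A `&` B) = (P A * P B)%E.

End Probability.

Section Model.
Context (R : realType).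

Definition discount (r : R) : R := (1 + r)^-1.

Definition up_prob (r lam : R) : R := (1 + r - lam^-1) / (lam - lam^-1).

Definition put (K x : R) : R := Num.max (K - x) 0.

Definition one_step (r lam : R) (phi : R -> R) : R -> R := fun x =>
  discount r *
    (up_prob r lam * phi (lam * x) + (1 - up_prob r lam) * phi (lam^-1 * x)).

(* eps i is the (i+1)-st step of the walk, so the sum is
   eps_1 + ... + eps_nu. *)
Definition price (T : Type) (S0 lam : R) (N : nat) (eps : 'I_N -> T -> R)
    (nu : nat) : T -> R :=
  fun w => S0 * lam `^ (\sum_(i < N | (i < nu)%N) eps i w).

(* The natural filtration: generated by S_0, ..., S_nu. *)
Definition natural_filtration (T : Type) (S : nat -> T -> R) (nu : nat) :
    set (set T) :=
  g_sigma_preimage (fun k : 'I_nu.+1 => S k).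

End Model.

Section DynamicProgram.
Context d (T : measurableType d) (R : realType) (P : probability T R).
Context (N : nat) (maturity : T -> nat) (r lam K : R).

(* pi_k, i.e. P(maturity >= N - n + 1 | maturity >= N - n) for n = k + 1;
   meaningful for k < N. *)
Definition survival (k : nat) : R :=
  cond_prob P [set w | (N - k <= maturity w)%N]
              [set w | (N - k.+1 <= maturity w)%N].

(* step k is the operator A_n of the recursion for n = k + 1. *)
Definition step (k : nat) (phi : R -> R) : R -> R :=
  fun x => survival k * one_step r lam phi x.

Fixpoint value (m n : nat) {struct n} : R -> R :=
  match m, n with
  | 0, _ => fun _ => 0
  | _.+1, 0 => put K
  | m'.+1, n'.+1 => fun x =>
      Num.max (put K x + step n' (value m' n') x) (step n' (value m'.+1 n') x)
  end.

Definition marginal_value (m n : nat) : R -> R :=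
  fun x => value m n x - value m.-1 n x.

Definition threshold_fun (m n : nat) : R -> R :=
  match n with
  | 0 => fun _ => 0
  | n'.+1 => step n' (marginal_value m n')
  end.

Definition exercise_set (m n : nat) : set R :=
  [set x | 0 < x <= K /\ threshold_fun m n x <= put K x].

Definition boundary (m n : nat) : R := sup (exercise_set m n).

End DynamicProgram.

Section Exercise.
Context d (T : measurableType d) (R : realType) (P : probability T R).
Context (N : nat) (maturity : T -> nat).

(* An exercise time; None is the symbol for non-exercise (= +oo). *)
Definition time := option 'I_N.+1.

Definition stopping_time (F : nat -> set (set T)) (tau : T -> time) : Prop :=
  forall nu : nat, (nu <= N)%N ->
    F nu [set w | exists2 v, tau w = Some v & (v <= nu)%N].

(* A vector (sigma_m, ..., sigma_1) is listed in the order of exercise: its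
   coordinate k : 'I_m, counted from 0, is sigma_(m - k). *)
Definition admissible (F : nat -> set (set T)) (m : nat)
    (sigma : 'I_m -> T -> time) : Prop :=
  (forall k, stopping_time F (sigma k)) /\
  (forall w, exists2 l : nat, (l <= m)%N &
     (forall k, (sigma k w : bool) = (k < l)%N) /\
     (forall (j k : 'I_m) u v, (j < k)%N ->
        sigma j w = Some u -> sigma k w = Some v -> (u < v)%N)).

Definition right_payoff (r K : R) (S : nat -> T -> R) (tau : T -> time)
    (w : T) : R :=
  if tau w is Some v then
    discount r ^+ v * (v <= maturity w)%N%:R * put K (S v w)
  else 0.

Definition expected_payoff (r K : R) (S : nat -> T -> R) (m : nat)
    (sigma : 'I_m -> T -> time) : \bar R :=
  ('E_P[(fun w => \sum_(k < m) right_payoff r K S (sigma k) w)%R])%E.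

Definition min_time (Q : pred 'I_N.+1) : time :=
  [pick v | Q v && [forall u, Q u ==> (v <= u)%N]].

Definition strictly_after (t : time) (v : 'I_N.+1) : bool :=
  if t is Some u then (u < v)%N else false.

(* The k-th scheduled exercise, k = 0, ..., m - 1, uses right number m - k;
   [D i n] is the exercise set with i rights left and n steps to go. *)
Fixpoint schedule (D : nat -> nat -> set R) (S : nat -> T -> R) (m k : nat)
    (w : T) : time :=
  match k with
  | 0 => min_time (fun v => S v w \in D m (N - v)%N)
  | k'.+1 => min_time (fun v => strictly_after (schedule D S m k' w) v
                       && (S v w \in D (m - k)%N (N - v)%N))
  end.

End Exercise.

(* Main.v *)
Require Import Defs.
From mathcomp Require Import all_boot all_order all_algebra.
From mathcomp Require Import all_classical all_reals all_analysis.
From mathcomp Require Import measurable_realfun.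
From mathcomp Require Import zify ring lra.

Set Implicit Arguments.
Unset Strict Implicit.
Unset Printing Implicit Defensive.

Import Order.TTheory GRing.Theory Num.Theory.
Import numFieldNormedType.Exports.

Local Open Scope classical_set_scope.
Local Open Scope ring_scope.

(** Writing dV_m for the marginal value of the m-th right and f_m for the
    threshold function, the recursion for the values becomes
    dV_1 = max(g, f_1) and dV_m = max(f_m, min(g, f_(m-1))) for m >= 2.
    Functions with slopes in [-1, 0] are stable under max, min and the
    discounted one-step operator, because the discounted price is a
    martingale; hence f_m(x) + x is nondecreasing and continuous, so that
    g >= f_m, that is f_m(x) + x <= K, cuts out an interval (0, x*], which is
    nonempty because f_m <= alpha K < K.  The same max-min formula propagates
    the monotonicity of f_m in m and in n.

    For optimality, an exercise schedule is a function on the tree of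
    up-down paths.  By independence the maturity enters the expected payoff
    only through P(maturity >= v), and the survival factors of the dynamic
    program are the ratios of these probabilities.  The accumulated gains plus
    the discounted value of the remaining rights then have nonincreasing mean
    along the tree, and constant mean under the threshold schedule. *)

(** * Functions with slopes in [-1, 0] *)

Section ThresholdShape.
Context (R : realType).
Implicit Types f g : R -> R.

(** Two monotonicity conditions replace a derivative; together they make f 1-Lipschitz. *)
Definition slope_between_m1_0 f :=
  {homo f : x y / x <= y >-> y <= x} /\ {homo (fun x => f x + x) : x y / x <= y}.

Lemma put_ge0 (K x : R) : 0 <= put K x.
Proof. by rewrite /put le_max lexx orbT. Qed.

Lemma put_le (K x : R) : x <= K -> put K x = K - x.
Proof. by move=> xK; apply/max_idPl; rewrite subr_ge0. Qed.

Lemma slope_put (K : R) : slope_between_m1_0 (put K).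
Proof.
split=> x y xy; rewrite /put.
  by rewrite !ge_max !le_max lexx !orbT andbT; lra.
rewrite !addr_maxl !ge_max !le_max; apply/andP; split; lra.
Qed.

Lemma slope_max f g : slope_between_m1_0 f -> slope_between_m1_0 g ->
  slope_between_m1_0 (fun x => Num.max (f x) (g x)).
Proof.
move=> [f1 f2] [g1 g2]; split=> x y xy.
  by rewrite ge_max !le_max f1 // g1 // orbT.
rewrite !addr_maxl ge_max !le_max.
by rewrite (f2 _ _ xy) (g2 _ _ xy) orbT.
Qed.

Lemma slope_min f g : slope_between_m1_0 f -> slope_between_m1_0 g ->
  slope_between_m1_0 (fun x => Num.min (f x) (g x)).
Proof.
move=> [f1 f2] [g1 g2]; split=> x y xy.
  by rewrite le_min !ge_min f1 // g1 // orbT.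
rewrite !addr_minl le_min !ge_min.
by rewrite (f2 _ _ xy) (g2 _ _ xy) orbT.
Qed.

Lemma slope_cst (c : R) : slope_between_m1_0 (fun _ => c).
Proof. by split=> x y //; rewrite lerD2l. Qed.

End ThresholdShape.

(** * The discounted one-step operator *)

Section OneStep.
Context (R : realType) (r lam : R).
Hypotheses (r_gt0 : 0 < r) (lam_gt1 : 1 < lam) (no_arb : lam^-1 < 1 + r < lam).

Local Notation al := (discount r).
Local Notation p := (up_prob r lam).
Local Notation A := (one_step r lam).

Lemma discount_gt0 : 0 < al.
Proof. by rewrite /discount invr_gt0 addr_gt0. Qed.

Lemma discount_lt1 : al < 1.
Proof. by rewrite /discount invf_lt1 ?ltrDl // addr_gt0. Qed.

Let lamV_lt : 0 < lam - lam^-1.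
Proof. by case/andP: no_arb => *; lra. Qed.

Lemma up_prob_gt0 : 0 < p.
Proof. by rewrite /up_prob divr_gt0 //; case/andP: no_arb => *; lra. Qed.

Lemma up_prob_lt1 : p < 1.
Proof.
by rewrite /up_prob ltr_pdivrMr // mul1r; case/andP: no_arb => *; lra.
Qed.

(** The discounted price is a martingale: [up_prob] is the weight that gives [lam] and [lam^-1] the
    mean 1 + r. *)
Lemma one_step_id x : A id x = x.
Proof.
rewrite /one_step /discount /up_prob.
have l0 : lam != 0 by rewrite gt_eqF // (lt_trans ltr01).
have r0 : 1 + r != 0 by rewrite gt_eqF // addr_gt0.
have l1 : lam ^+ 2 - 1 != 0.
  by rewrite gt_eqF // subr_gt0 exprn_egt1.
by field; rewrite l0 r0 -expr2 l1.
Qed.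

Lemma one_step_cst c x : A (fun _ => c) x = al * c.
Proof. by rewrite /one_step -mulrDl addrC subrK mul1r. Qed.

Lemma one_stepD f g x : A (fun y => f y + g y) x = A f x + A g x.
Proof. by rewrite /one_step; ring. Qed.

Lemma one_stepB f g x : A (fun y => f y - g y) x = A f x - A g x.
Proof. by rewrite /one_step; ring. Qed.

Lemma ler_one_step f g x :
  f (lam * x) <= g (lam * x) -> f (lam^-1 * x) <= g (lam^-1 * x) ->
  A f x <= A g x.
Proof.
move=> h1 h2; rewrite /one_step ler_pM2l ?discount_gt0 //.
apply: lerD; first by rewrite ler_pM2l ?up_prob_gt0.
by rewrite ler_pM2l // subr_gt0 up_prob_lt1.
Qed.

(** Monotonicity passes through positive weights. For the second half, the martingale identity
    splits c A f + id into c A (f + id) and (1 - c) id, both nondecreasing. *)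
Lemma slope_one_step (c : R) f : 0 <= c <= 1 ->
  slope_between_m1_0 f -> slope_between_m1_0 (fun x => c * A f x).
Proof.
move=> /andP[c0 c1] [f1 f2].
have l0 : 0 < lam by rewrite (lt_trans ltr01).
have lV0 : 0 < lam^-1 by rewrite invr_gt0.
split=> x y xy.
  apply: ler_wpM2l => //; rewrite /one_step ler_pM2l ?discount_gt0 //.
  apply: lerD; first by rewrite ler_pM2l ?up_prob_gt0 // f1 // ler_pM2l.
  by rewrite ler_pM2l ?subr_gt0 ?up_prob_lt1 // f1 // ler_pM2l.
have E z : c * A f z + z = c * A (fun y => f y + y) z + (1 - c) * z.
  by rewrite one_stepD -{2}(one_step_id z); rewrite (one_step_id z); ring.
rewrite !E; apply: lerD; last by rewrite ler_wpM2l // subr_ge0.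
apply: ler_wpM2l => //; rewrite /one_step ler_pM2l ?discount_gt0 //.
apply: lerD; first by rewrite ler_pM2l ?up_prob_gt0 // f2 // ler_pM2l.
by rewrite ler_pM2l ?subr_gt0 ?up_prob_lt1 // f2 // ler_pM2l.
Qed.

End OneStep.

(** * Interval form of the exercise region *)

Section ExerciseRegion.
Context (R : realType) (K : R) (f : R -> R).
Hypothesis f_slope : slope_between_m1_0 f.

Let region := [set x | 0 < x <= K /\ f x <= put K x].

(** On (0, K] membership reads f x + x <= K, which smaller points inherit; continuity of f puts the
    supremum itself into the region. *)
Lemma region_sup_interval (x0 : R) : region x0 ->
  has_sup region /\ region = `]0, sup region]%classic.
Proof.
move=> Rx0.
have hs : has_sup region.
  by split; [exists x0 | exists K => x [/andP[]]].
have s0 : 0 < sup region.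
  by apply: (lt_le_trans _ (ub_le_sup hs.2 Rx0)); case: Rx0 => /andP[].
have sK : sup region <= K by apply: ge_sup hs.1 _ => x [/andP[]].
split=> //; apply/seteqP; split=> x /=.
  by move=> Rx; rewrite in_itv /= (ub_le_sup hs.2 Rx) andbT; case: Rx => /andP[].
rewrite in_itv /= => /andP[x_gt0 x_le]; have xK := le_trans x_le sK.
split; first by rewrite x_gt0.
rewrite put_le // lerBrDr.
apply: (le_trans (f_slope.2 _ _ x_le)).
(* Approximation of the supremum: for y in the region within e of it, f at the supremum is at most f
   y, so the sum exceeds f y + y <= K by at most e. *)
apply/ler_addgt0Pr => e e0.
have [y Ry ye] := sup_adherent e0 hs.
have ys : y <= sup region := ub_le_sup hs.2 Ry.
have fy : f y + y <= K by case: Ry => /andP[_ yK]; rewrite put_le // lerBrDr.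
have := f_slope.1 _ _ ys; lra.
Qed.

End ExerciseRegion.

Lemma le_sup_sub (R : realType) (A B : set R) :
  has_sup A -> has_sup B -> A `<=` B -> sup A <= sup B.
Proof. by move=> sA sB AB; apply: ge_sup sA.1 _ => x /AB /ub_le_sup; apply; exact: sB.2. Qed.

(** * Monotonicity of the max-min formulas *)

Section MaxMin.
Context (R : realType).
Implicit Types a b c g : R.

Lemma max_le_max a b c g : a <= b -> c <= g -> Num.max a c <= Num.max b g.
Proof. by move=> ab cg; rewrite ge_max !le_max ab cg orbT. Qed.

Lemma min_le_min a b c g : a <= b -> c <= g -> Num.min a c <= Num.min b g.
Proof. by move=> ab cg; rewrite le_min !ge_min ab cg orbT. Qed.

Lemma max_min_le_max a b g : a <= b -> Num.max a (Num.min g b) <= Num.max g b.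
Proof. by move=> ab; rewrite ge_max !le_max ab orbT ge_min lexx. Qed.

(** With a, b, c = f_(m+2), f_(m+1), f_m this compares dV_(m+2) with dV_(m+1): both entries on the
    left are at most b. *)
Lemma max_min_le_max_min a b c g : a <= b ->
  Num.max a (Num.min g b) <= Num.max b (Num.min g c).
Proof. by move=> ab; rewrite ge_max !le_max ab /= !ge_min lexx orbT. Qed.

End MaxMin.

(** * Marginal values and threshold functions *)

Section MarginalValues.
Context d (T : measurableType d) (R : realType) (P : probability T R).
Context (N : nat) (maturity : {RV P >-> nat}) (r lam K : R).
Hypotheses (r_gt0 : 0 < r) (lam_gt1 : 1 < lam) (no_arb : lam^-1 < 1 + r < lam).
Hypothesis (K_gt0 : 0 < K).

Local Notation V := (value P N maturity r lam K).
Local Notation dV := (marginal_value P N maturity r lam K).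
Local Notation f := (threshold_fun P N maturity r lam K).
Local Notation D := (exercise_set P N maturity r lam K).
Local Notation pi := (survival P N maturity).
Local Notation stp := (step P N maturity r lam).
Local Notation g := (put K).

Lemma measurable_maturity_ge n : measurable [set w | (n <= maturity w)%N].
Proof.
rewrite (_ : mkset _ = maturity @^-1` [set k | (n <= k)%N]) //.
by rewrite -[X in measurable X]setTI; exact: measurable_funP.
Qed.

Lemma survival_ge0_le1 k : 0 <= pi k <= 1.
Proof.
rewrite /survival /cond_prob; set A := mkset _; set B := mkset _.
have AB : A `<=` B by move=> w /=; apply: leq_trans; rewrite leq_sub2l.
have mA : measurable A := measurable_maturity_ge _.
have mB : measurable B := measurable_maturity_ge _.
rewrite (setIidl AB) divr_ge0 ?fine_ge0 //=.
have le : fine (P A) <= fine (P B).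
  by apply: fine_le; rewrite ?fin_num_measure //; apply: le_measure; rewrite ?inE.
(* If the conditioning event is null, the quotient is 0 by the convention on inverses. *)
have [->|B0] := eqVneq (fine (P B)) 0; first by rewrite invr0 mulr0 ler01.
by rewrite ler_pdivrMr ?mul1r // lt_def B0 fine_ge0.
Qed.

Lemma step_ge0 n phi x : (forall y, 0 <= phi y) -> 0 <= stp n phi x.
Proof.
move=> h; rewrite /step mulr_ge0 //; first by case/andP: (survival_ge0_le1 n).
(* Zero is the image of the constant 0, so nonnegativity becomes monotonicity of the operator. *)
by rewrite -(mulr0 (discount r)) -(one_step_cst r lam 0 x); exact: ler_one_step.
Qed.

Lemma ler_step n phi psi x : (forall y, phi y <= psi y) ->
  stp n phi x <= stp n psi x.
Proof.
move=> h; rewrite /step ler_wpM2l //; first by case/andP: (survival_ge0_le1 n).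
exact: ler_one_step.
Qed.

Lemma value0m n x : V 0 n x = 0. Proof. by case: n. Qed.

Lemma step_value0 n k x : stp n (V 0 k) x = 0.
Proof. by rewrite /step /one_step !value0m; ring. Qed.

Lemma threshold_funS m n x :
  f m.+1 n.+1 x = stp n (V m.+1 n) x - stp n (V m n) x.
Proof. by rewrite /= /step -mulrBr -one_stepB. Qed.

Lemma marginal_value1 n x : dV 1 n x = Num.max (g x) (f 1 n x).
Proof.
rewrite /marginal_value value0m subr0; case: n => [|n].
  by rewrite /= max_l // put_ge0.
by rewrite threshold_funS /= !step_value0 addr0 subr0.
Qed.

(** Let a, b, c be the continuation values with m + 2, m + 1 and m rights. Then dV is max(g + b, a)
    - max(g + c, b), the threshold functions are a - b and b - c, and the hypothesis a - b <= b - c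
    leaves a case check. *)
Lemma marginal_valueSS m n x : f m.+2 n x <= f m.+1 n x ->
  dV m.+2 n x = Num.max (f m.+2 n x) (Num.min (g x) (f m.+1 n x)).
Proof.
rewrite /marginal_value; case: n => [|n].
  by move=> _ /=; rewrite subrr min_r ?put_ge0 // maxxx.
rewrite !threshold_funS /=.
set a := stp n (V m.+2 n) x; set b := stp n (V m.+1 n) x.
set c := stp n (V m n) x; move=> le.
by rewrite /Num.max /Num.min; do ! case: ifPn; rewrite -?leNgt; lra.
Qed.

(** The induction on n alternates between this statement and the next: the max-min formula leads
    from threshold functions to marginal values at the same n, and the step operator leads on to n +
    1. The ordering in m is the hypothesis of [marginal_valueSS]. *)
Let threshold_shape n := forall m,
  [/\ slope_between_m1_0 (f m.+1 n), (forall x, 0 <= f m.+1 n x)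
    & (forall x, f m.+2 n x <= f m.+1 n x)].

Let marginal_shape n := forall m,
  [/\ slope_between_m1_0 (dV m.+1 n), (forall x, 0 <= dV m.+1 n x)
    & (forall x, dV m.+2 n x <= dV m.+1 n x)].

Let threshold_marginal_shape n : threshold_shape n -> marginal_shape n.
Proof.
move=> H.
have le1 x : dV 2 n x <= dV 1 n x.
  have [_ _ h] := H 0%N; rewrite marginal_valueSS // marginal_value1.
  exact: max_min_le_max.
have leS m x : dV m.+3 n x <= dV m.+2 n x.
  have [_ _ h] := H m.+1; have [_ _ h0] := H m.
  rewrite !marginal_valueSS //.
  exact: max_min_le_max_min.
case=> [|m].
  have [fs f0 h] := H 0%N.
  split=> [|x|x]; last exact: le1.
    rewrite (_ : dV 1 n = fun x => Num.max (g x) (f 1 n x)); last first.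
      by apply/funext => x; exact: marginal_value1.
    by apply: slope_max => //; exact: slope_put.
  by rewrite marginal_value1 le_max put_ge0.
have [fs f0 h] := H m; have [fs1 f1 h1] := H m.+1.
split=> [|x|x]; last exact: leS.
  rewrite (_ : dV m.+2 n =
      fun x => Num.max (f m.+2 n x) (Num.min (g x) (f m.+1 n x))); last first.
    by apply/funext => x; exact: marginal_valueSS.
  by apply: slope_max => //; apply: slope_min => //; exact: slope_put.
by rewrite marginal_valueSS // le_max f1.
Qed.

Lemma threshold_fun_shape n m :
  [/\ slope_between_m1_0 (f m.+1 n), (forall x, 0 <= f m.+1 n x)
    & (forall x, f m.+2 n x <= f m.+1 n x)].
Proof.
elim: n m => [|n IH] m; first by split=> //; exact: slope_cst.
have [s p0 le] := threshold_marginal_shape IH m.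
split=> [|x|x]; last exact: ler_step.
  exact: slope_one_step (survival_ge0_le1 n) s.
exact: step_ge0.
Qed.

Lemma marginal_value_shape n m :
  [/\ slope_between_m1_0 (dV m.+1 n), (forall x, 0 <= dV m.+1 n x)
    & (forall x, dV m.+2 n x <= dV m.+1 n x)].
Proof. by apply: threshold_marginal_shape => k; exact: threshold_fun_shape. Qed.

(** One more right is worth at most K, because g <= K on x >= 0, and a step discounts this bound.
    That it lies strictly below K makes the exercise sets nonempty. *)
Lemma threshold_fun_le n m x : 0 <= x -> f m.+1 n x <= discount r * K.
Proof.
have a0 := discount_gt0 r_gt0; have a1 := discount_lt1 r_gt0.
elim: n m x => [|n IH] m x x0; first by rewrite /= mulr_ge0 // ltW.
have dVK y : 0 <= y -> dV m.+1 n y <= K.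
  move=> y0.
  have fK k : f k.+1 n y <= K.
    by apply: (le_trans (IH k y y0)); rewrite ler_piMl // ltW.
  have gK : g y <= K by rewrite /put ge_max (ltW K_gt0) andbT gerBl.
  case: m => [|m]; first by rewrite marginal_value1 ge_max gK fK.
  have [_ _ h] := threshold_fun_shape n m.
  by rewrite marginal_valueSS // ge_max fK ge_min gK.
have l0 : 0 < lam by rewrite (lt_trans ltr01).
have [_ p0 _] := marginal_value_shape n m.
have /andP[s0 s1] := survival_ge0_le1 n.
rewrite /= /step -(one_step_cst r lam K x).
have le : one_step r lam (dV m.+1 n) x <= one_step r lam (fun=> K) x.
  by apply: ler_one_step => //; apply: dVK; rewrite mulr_ge0 ?invr_ge0 // ltW.
apply: le_trans le; rewrite ler_piMl //.
rewrite -(mulr0 (discount r)) -(one_step_cst r lam 0 x).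
by apply: ler_one_step.
Qed.

Lemma exercise_setE m n :
  has_sup (D m.+1 n) /\ D m.+1 n = `]0, boundary P N maturity r lam K m.+1 n]%classic.
Proof.
have a1 := discount_lt1 r_gt0; have a0 := discount_gt0 r_gt0.
have [fs _ _] := threshold_fun_shape n m.
(* At this witness g equals alpha K, the bound on the threshold function. *)
apply: (@region_sup_interval R K _ fs (K * (1 - discount r))).
have x0 : 0 < K * (1 - discount r) by rewrite mulr_gt0 // subr_gt0.
have xK : K * (1 - discount r) <= K.
  by have K0 := K_gt0; rewrite ler_piMr; lra.
split; first by rewrite x0.
rewrite put_le //; apply: le_trans (threshold_fun_le n m (ltW x0)) _.
by rewrite mulrBr mulr1 subKr mulrC.
Qed.

Lemma boundary_incr_rights m n :
  boundary P N maturity r lam K m.+1 n <= boundary P N maturity r lam K m.+2 n.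
Proof.
apply: le_sup_sub; [exact: (exercise_setE _ _).1..|].
move=> x [xK le]; split=> //; apply: le_trans le.
by have [_ _] := threshold_fun_shape n m.
Qed.

(** * Monotonicity in the time to go under nondecreasing survival factors *)

Section DecreasingHazard.
Hypothesis pi_homo : forall k : nat, (k.+1 < N)%N -> pi k <= pi k.+1.

(** The max-min formula is monotone in its threshold functions, so dV grows from n to n + 1; the
    next step then applies a larger survival factor to a larger nonnegative function. *)
Lemma threshold_fun_incr_steps n m x : (n < N)%N ->
  f m.+1 n x <= f m.+1 n.+1 x.
Proof.
elim: n m x => [|n IH] m x nN.
  by have [_ h _] := threshold_fun_shape 1 m.
have dVle y : dV m.+1 n y <= dV m.+1 n.+1 y.
  case: m => [|m].
    by rewrite !marginal_value1 max_le_max // IH // ltnW.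
  have [_ _ h] := threshold_fun_shape n m.
  have [_ _ h1] := threshold_fun_shape n.+1 m.
  by rewrite !marginal_valueSS // max_le_max ?min_le_min ?IH // ltnW.
rewrite [leLHS]/= [leRHS]/= [leLHS]/step.
have [_ p0 _] := marginal_value_shape n m.
have ge0 : 0 <= one_step r lam (dV m.+1 n) x.
  by rewrite -(mulr0 (discount r)) -(one_step_cst r lam 0 x) ler_one_step.
apply: (le_trans (ler_wpM2r ge0 (pi_homo nN))).
exact: ler_step.
Qed.

Lemma boundary_decr_steps m n : (n < N)%N ->
  boundary P N maturity r lam K m.+1 n.+1 <= boundary P N maturity r lam K m.+1 n.
Proof.
move=> nN; apply: le_sup_sub; [exact: (exercise_setE _ _).1..|].
by move=> x [xK le]; split=> //; apply: le_trans le; exact: threshold_fun_incr_steps.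
Qed.

End DecreasingHazard.

(** Supermartingale half of the verification: e is the number of rights used now, and e = 0, 1
    select the two entries of the maximum; with no right left both sides vanish. *)
Lemma value_ge m n x (e : nat) : (e <= m)%N -> (e <= 1)%N ->
  e%:R * g x + stp n (V (m - e) n) x <= V m n.+1 x.
Proof.
case: e => [|[|//]] em _.
  rewrite mul0r add0r subn0; case: m em => [|m] _; first by rewrite step_value0 value0m.
  by rewrite /= le_max lexx orbT.
by case: m em => // m _; rewrite mul1r subn1 /= le_max lexx.
Qed.

(** Martingale half: the threshold function is the difference of the two continuation values, so
    exercising exactly on the exercise set picks the larger entry. *)
Lemma value_eq m n x (e : nat) : 0 < x ->
  e = (0 < m)%N && (x \in D m n.+1) ->
  e%:R * g x + stp n (V (m - e) n) x = V m n.+1 x.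
Proof.
move=> x0; case: m => [|m] ->; first by rewrite mul0r add0r step_value0 value0m.
rewrite /=; have := threshold_funS m n x.
case: (boolP (x \in _)) => [/set_mem[_ le]|/negP nD] E.
  rewrite mul1r subn1 /= max_l //; move: le; rewrite E; lra.
rewrite mul0r add0r subn0 max_r //.
suff : g x <= f m.+1 n.+1 x by rewrite E; lra.
(* Outside the set, either x <= K and the threshold inequality fails, or x > K, where g vanishes and
   the threshold function is nonnegative. *)
have [xK|Kx] := leP x K.
  by rewrite leNgt; apply/negP => /ltW le; apply: nD; rewrite inE; split=> //; rewrite x0.
rewrite /put max_r; last by rewrite subr_le0 ltW.
by have [_ ->] := threshold_fun_shape n.+1 m.
Qed.

Lemma value0_ge m x (e : nat) : (e <= m)%N -> (e <= 1)%N -> e%:R * g x <= V m 0 x.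
Proof.
case: e => [|[|//]] em _; last by case: m em => // m _; rewrite mul1r.
by rewrite mul0r; case: m em => [|m] _ /=; rewrite ?lexx ?put_ge0.
Qed.

Lemma value0_eq m x (e : nat) : 0 < x ->
  e = (0 < m)%N && (x \in D m 0) -> e%:R * g x = V m 0 x.
Proof.
move=> x0; case: m => [|m] ->; first by rewrite mul0r.
rewrite /=; case: (boolP (x \in _)) => [_|/negP nD]; first by rewrite mul1r.
(* With no step to go the threshold function is 0 and the set is all of (0, K], so being outside
   means x > K. *)
rewrite mul0r /put max_r // leNgt subr_gt0; apply/negP => /ltW xK; apply: nD.
by rewrite inE; split; [rewrite x0|rewrite /= put_ge0].
Qed.

End MarginalValues.

(** * The natural filtration of the price *)

Section NaturalFiltration.
Context d (T : measurableType d) (R : realType) (S : nat -> T -> R).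

Local Notation F := (natural_filtration S).

Lemma natural_filtration_ind nu (G : set (set T)) : sigma_algebra setT G ->
  (forall k B, (k <= nu)%N -> measurable B -> G (S k @^-1` B)) -> F nu `<=` G.
Proof.
move=> sG GS; apply: smallest_sub => // A.
rewrite -bigcup_mkord_ord => -[k /= kn [B mB <-]].
by rewrite setTI; apply: GS mB; rewrite inordK.
Qed.

Lemma preimage_natural_filtration nu k (B : set R) : (k <= nu)%N ->
  measurable B -> F nu (S k @^-1` B).
Proof.
move=> kn mB; apply: sub_sigma_algebra; rewrite -bigcup_mkord_ord.
by exists k => //; exists B => //; rewrite inordK // setTI.
Qed.

Lemma natural_filtration_homo mu nu : (mu <= nu)%N -> F mu `<=` F nu.
Proof.
move=> mn; apply: natural_filtration_ind; first exact: smallest_sigma_algebra.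
by move=> k B km mB; apply: preimage_natural_filtration => //; apply: leq_trans mn.
Qed.

Lemma natural_filtration_measurable nu :
  (forall k, measurable_fun setT (S k)) -> F nu `<=` measurable.
Proof.
move=> mS; apply: natural_filtration_ind; first exact: sigma_algebra_measurable.
by move=> k B _ mB; rewrite -[X in measurable X]setTI; exact: mS.
Qed.

(** The sets that do not separate w from w' form a sigma-algebra containing the generators. This is
    how stopping rules become functions of the price path. *)
Lemma natural_filtration_agree nu A w w' : F nu A ->
  (forall k, (k <= nu)%N -> S k w = S k w') -> A w <-> A w'.
Proof.
move=> FA ag; move: A FA.
apply: natural_filtration_ind => [|k B kn _]; last by rewrite /preimage /= ag.
split=> // [A IH|A IH]; first by rewrite /= IH.
by split=> -[k _ Ak]; exists k => //; apply/IH.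
Qed.

Lemma natural_filtrationI nu A B : F nu A -> F nu B -> F nu (A `&` B).
Proof.
(* Naming the generators lets F nu be read as the measurable sets of [g_sigma_algebraType G]. *)
pose G := \big[setU/set0]_(i < nu.+1) preimage_set_system setT (S i) measurable.
exact: (@measurableI _ (g_sigma_algebraType G)).
Qed.

Lemma natural_filtration_bigcap n nu (A : nat -> set T) :
  (forall k, (k < n)%N -> F nu (A k)) -> F nu (\bigcap_(k in `I_n) A k).
Proof.
pose G := \big[setU/set0]_(i < nu.+1) preimage_set_system setT (S i) measurable.
move=> FA; exact: (@bigcap_measurableType _ (g_sigma_algebraType G)).
Qed.

Lemma natural_filtration_bigcup n nu (A : nat -> set T) :
  (forall k, (k < n)%N -> F nu (A k)) -> F nu (\bigcup_(k in `I_n) A k).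
Proof.
pose G := \big[setU/set0]_(i < nu.+1) preimage_set_system setT (S i) measurable.
move=> FA; exact: (@bigcup_measurable _ (g_sigma_algebraType G)).
Qed.

End NaturalFiltration.

(** * Exercise times and first hitting times *)

Section Times.
Context (N : nat).
Implicit Types t : time N.

(** Non-exercise behaves as +oo: this comparison and the next are false there for every v. *)
Definition time_eq t (v : nat) := if t is Some u then (u : nat) == v else false.
Definition time_lt t (v : nat) := if t is Some u then (u < v)%N else false.

Lemma strictly_afterE t (v : 'I_N.+1) : strictly_after t v = time_lt t v.
Proof. by []. Qed.

Lemma time_ltn0 t : time_lt t 0 = false.
Proof. by case: t. Qed.

Lemma time_ltS t v : time_lt t v.+1 = time_eq t v || time_lt t v.
Proof. by case: t => [u|] //=; rewrite ltnS leq_eqVlt. Qed.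

Lemma time_ltS_add t v : (time_lt t v.+1 : nat) = (time_lt t v + time_eq t v)%N.
Proof.
by rewrite time_ltS; case: t => [u|] //=; case: ltngtP.
Qed.

Lemma time_eqE t v : time_eq t v = time_lt t v.+1 && ~~ time_lt t v.
Proof. by case: t => [u|] //=; rewrite ltnS -leqNgt eqn_leq. Qed.

Variant min_time_spec (Q : pred 'I_N.+1) : time N -> Prop :=
| MinTimeSome v of Q v & (forall u, Q u -> (v <= u)%N) : min_time_spec Q (Some v)
| MinTimeNone of (forall u, ~~ Q u) : min_time_spec Q None.

Lemma min_timeP (Q : pred 'I_N.+1) : min_time_spec Q (min_time Q).
Proof.
rewrite /min_time; case: pickP => [v /andP[Qv /forallP h]|h].
  by constructor=> // u Qu; exact: (implyP (h u)).
constructor=> u; apply/negP => Qu.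
case: (arg_minnP (fun v : 'I_N.+1 => v : nat) Qu) => v Qv minv.
have := h v; rewrite Qv /= => /negP; apply; apply/forallP => x.
by apply/implyP; exact: minv.
Qed.

Lemma min_time_lt (Q : pred 'I_N.+1) n :
  time_lt (min_time Q) n <-> exists2 v, Q v & (v < n)%N.
Proof.
case: min_timeP => [v Qv minv|h] /=; split=> //.
- by move=> vn; exists v.
- by move=> [u /minv]; exact: leq_ltn_trans.
- by move=> [u Qu]; have := h u; rewrite Qu.
Qed.

End Times.

Lemma sum_ord_ltn m c : (\sum_(j < m) (j < c) = minn m c)%N.
Proof.
elim: m => [|m IH]; first by rewrite big_ord0 min0n.
by rewrite big_ord_recr /= IH; lia.
Qed.

(** A downward closed set of indices is an initial segment, hence determined by its size; the size
    is compared with those of the segments of length k + 1 and k. *)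
Lemma downward_closedE m (Q : pred 'I_m) (k : 'I_m) :
  (forall i j : 'I_m, (i <= j)%N -> Q j -> Q i) -> Q k = (k < \sum_(j < m) Q j)%N.
Proof.
move=> down; have [Qk|nQk] := boolP (Q k); apply/esym.
  have <- : (\sum_(j < m) (j < k.+1) = k.+1)%N.
    by rewrite sum_ord_ltn; apply/minn_idPr.
  apply: leq_sum => j _; rewrite ltnS; case: (leqP j k) => //= jk.
  by rewrite (down _ _ jk Qk).
apply: negbTE; rewrite -leqNgt.
have <- : (\sum_(j < m) (j < k) = k)%N.
  by rewrite sum_ord_ltn; apply/minn_idPr; exact: ltnW.
apply: leq_sum => j _; case: (ltnP j k) => jk; first exact: leq_b1.
by rewrite leqn0 eqb0; apply: contra nQk; exact: down.
Qed.

(** * Counting exercises along a path *)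

Section Counting.
Context d (T : measurableType d) (R : realType) (N m : nat).
Context (sigma : 'I_m -> T -> time N).

Definition pathwise_admissible (w : T) := exists2 l : nat, (l <= m)%N &
     (forall k, (sigma k w : bool) = (k < l)%N) /\
     (forall (j k : 'I_m) u v, (j < k)%N ->
        sigma j w = Some u -> sigma k w = Some v -> (u < v)%N).

(** The total payoff and the number of rights left depend on the strategy only through this count
    and the next. *)
Definition exercises_at (v : nat) (w : T) : nat := \sum_(k < m) time_eq (sigma k w) v.
Definition exercises_before (v : nat) (w : T) : nat :=
  \sum_(k < m) time_lt (sigma k w) v.

Lemma exercises_before0 w : exercises_before 0 w = 0%N.
Proof. by rewrite /exercises_before big1 // => k _; rewrite time_ltn0. Qed.

Lemma exercises_beforeS v w :
  exercises_before v.+1 w = (exercises_before v w + exercises_at v w)%N.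
Proof.
by rewrite /exercises_before -big_split /=; apply: eq_bigr => k _; exact: time_ltS_add.
Qed.

Lemma exercises_before_le v w : (exercises_before v w <= m)%N.
Proof.
rewrite -[leqRHS]card_ord -sum1_card; apply: leq_sum => k _; exact: leq_b1.
Qed.

Lemma exercises_at_rights v w : (exercises_at v w <= m - exercises_before v w)%N.
Proof.
by rewrite leq_subRL ?exercises_before_le // -exercises_beforeS exercises_before_le.
Qed.

Lemma time_lt_prefix w (j k : 'I_m) v : pathwise_admissible w ->
  (j <= k)%N -> time_lt (sigma k w) v -> time_lt (sigma j w) v.
Proof.
move=> [l _ [fin inc]]; rewrite leq_eqVlt => /predU1P[/val_inj->//|jk].
case Ek : (sigma k w) => [u|//] /= uv.
have := fin j; have := fin k; rewrite Ek /= => /esym kl; rewrite (ltn_trans jk kl).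
case Ej : (sigma j w) => [u'|//] _ /=.
exact: ltn_trans (inc _ _ _ _ jk Ej Ek) uv.
Qed.

Lemma exercises_at_le1 w v : pathwise_admissible w -> (exercises_at v w <= 1)%N.
Proof.
move=> [l _ [fin inc]]; rewrite /exercises_at.
have [k Hk|none] := pickP (fun k => time_eq (sigma k w) v); last first.
  by rewrite big1 // => k _; rewrite none.
rewrite (bigD1 k) //= big1 ?addn0 ?leq_b1 // => j jk; apply/eqP; rewrite eqb0.
apply/negP => Hj; move: Hk Hj.
case Ek : (sigma k w) => [u|//]; case Ej : (sigma j w) => [u'|//] /= /eqP uv /eqP u'v.
move: jk; rewrite neq_ltn => /orP[jk|kj].
  by have := inc _ _ _ _ jk Ej Ek; rewrite uv u'v ltnn.
by have := inc _ _ _ _ kj Ek Ej; rewrite uv u'v ltnn.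
Qed.

Lemma time_ltE w v (k : 'I_m) : pathwise_admissible w ->
  time_lt (sigma k w) v = (k < exercises_before v w)%N.
Proof.
move=> adm.
apply: (downward_closedE (Q := fun j => time_lt (sigma j w) v)) => i j ij.
exact: time_lt_prefix.
Qed.

(** The rights are regrouped by the date of their exercise. *)
Lemma sum_right_payoffE (maturity : T -> nat) (r K : R) (S : nat -> T -> R) w :
  \sum_(k < m) right_payoff maturity r K S (sigma k) w =
  \sum_(v < N.+1) (exercises_at v w)%:R *
     (discount r ^+ v * (v <= maturity w)%N%:R * put K (S v w)).
Proof.
under eq_bigr => k _.
  rewrite (_ : right_payoff _ _ _ _ _ _ = \sum_(v < N.+1) (time_eq (sigma k w) v)%:R *
     (discount r ^+ v * (v <= maturity w)%N%:R * put K (S v w))); first over.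
  rewrite /right_payoff; case: (sigma k w) => [u|] /=; last first.
    by rewrite big1 // => v _; rewrite mul0r.
  rewrite (bigD1 u) //= eqxx mul1r big1 ?addr0 // => v vu.
  by rewrite (_ : (u : nat) == v = false) ?mul0r // eq_sym; exact: negbTE.
rewrite exchange_big /=; apply: eq_bigr => v _.
by rewrite -mulr_suml -natr_sum.
Qed.

End Counting.

(** * Stopping times on paths with a common past *)

Section StoppingTimes.
Context d (T : measurableType d) (R : realType) (N : nat) (S : nat -> T -> R).

Local Notation F := (natural_filtration S).

Lemma stopping_timeE (tau : T -> time N) :
  stopping_time F tau <->
  forall nu, (nu <= N)%N -> F nu [set w | time_lt (tau w) nu.+1].
Proof.
suff E nu : [set w | exists2 v, tau w = Some v & (v <= nu)%N] =
            [set w | time_lt (tau w) nu.+1].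
  by split=> h nu nuN; move: (h nu nuN); rewrite E.
apply/seteqP; split=> w /=; first by move=> [v ->].
by case: (tau w) => // v; exists v.
Qed.

Lemma stopping_time_measurable (tau : T -> time N) v : (forall k, measurable_fun setT (S k)) ->
  stopping_time F tau -> (v <= N)%N -> measurable [set w | time_eq (tau w) v].
Proof.
move=> mS /stopping_timeE st vN.
have mlt u : (u <= N.+1)%N -> measurable [set w | time_lt (tau w) u].
  case: u => [_|u uN].
    by rewrite (_ : mkset _ = set0) //; apply/seteqP; split=> w //=; rewrite time_ltn0.
  exact: natural_filtration_measurable mS _ (st u uN).
rewrite (_ : mkset _ = [set w | time_lt (tau w) v.+1] `\` [set w | time_lt (tau w) v]).
  by apply: measurableD; apply: mlt => //; exact: leqW.
by apply/seteqP; split=> w /=; rewrite time_eqE; [move=> /andP[-> /negP] | move=> [-> /negP]].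
Qed.

Section Agreement.
Context (m : nat) (sigma : 'I_m -> T -> time N) (nu : nat) (w w' : T).
Hypotheses (st : forall k, stopping_time F (sigma k)) (nuN : (nu <= N)%N).
Hypothesis agree : forall k, (k <= nu)%N -> S k w = S k w'.

(** Being before v + 1 means being exercised by v, an event of F v; hence the range of v reaches nu
    + 1. *)
Lemma time_lt_agree k v : (v <= nu.+1)%N ->
  time_lt (sigma k w) v = time_lt (sigma k w') v.
Proof.
case: v => [|v]; first by rewrite !time_ltn0.
rewrite ltnS => vnu.
have /stopping_timeE/(_ v (leq_trans vnu nuN)) FA := st k.
have ag u : (u <= v)%N -> S u w = S u w' by move=> uv; apply/agree/(leq_trans uv).
by have [/= h1 h2] := natural_filtration_agree FA ag; apply/idP/idP.
Qed.

Lemma exercises_before_agree v : (v <= nu.+1)%N ->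
  exercises_before sigma v w = exercises_before sigma v w'.
Proof.
by move=> vnu; apply: eq_bigr => k _; rewrite time_lt_agree.
Qed.

Lemma exercises_at_agree v : (v <= nu)%N ->
  exercises_at sigma v w = exercises_at sigma v w'.
Proof.
move=> vnu; apply: eq_bigr => k _.
by rewrite !time_eqE !time_lt_agree // ltnW.
Qed.

End Agreement.

End StoppingTimes.

(** * The threshold schedule *)

Section Schedule.
Context d (T : measurableType d) (R : realType) (N : nat) (S : nat -> T -> R).
Context (D : nat -> nat -> set R) (m : nat).

Local Notation sched := (fun k : 'I_m => schedule N D S m k).

Lemma scheduleE k w : schedule N D S m k w =
  min_time (fun v => (if k is k'.+1 then time_lt (schedule N D S m k' w) v else true)
    && (S v w \in D (m - k)%N (N - v)%N)).
Proof. by case: k => [|k] //=; rewrite subn0. Qed.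

Lemma schedule_increasing j k w u v : (j < k)%N ->
  schedule N D S m j w = Some u -> schedule N D S m k w = Some v -> (u < v)%N.
Proof.
elim: k v => // k IH v; rewrite ltnS leq_eqVlt => jk Ej.
rewrite scheduleE; case: min_timeP => // v' /andP[lt _] _ [<-].
case Ek : (schedule N D S m k w) lt => [u'|//] u'v'.
case/predU1P: jk Ej => [->|jk] Ej; first by move: Ej u'v'; rewrite Ek => -[->].
exact: ltn_trans (IH _ jk Ej Ek) u'v'.
Qed.

Lemma schedule_pathwise_admissible w : pathwise_admissible sched w.
Proof.
exists (\sum_(k < m) (sched k w : bool))%N.
  by rewrite -[leqRHS]card_ord -sum1_card; apply: leq_sum => k _; exact: leq_b1.
split=> [k|j k u v]; last exact: schedule_increasing.
apply: (downward_closedE (Q := fun k => sched k w : bool)) => /= i j ij.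
(* One step back suffices: after a non-exercised right, [strictly_after] is false and the next
   search finds nothing. *)
rewrite -(subnKC ij); elim: (j - i)%N => [|n IH]; first by rewrite addn0.
move=> h; apply: IH; move: h; rewrite addnS scheduleE.
by case: min_timeP => // v /andP[]; case: schedule.
Qed.

(** Exercise by nu is a finite union over v <= nu of events where the price lies in D at v and the
    preceding right was used before v. *)
Lemma schedule_stopping_time k :
  (forall i n, (0 < i)%N -> (n <= N)%N -> measurable (D i n)) ->
  (k < m)%N -> stopping_time (natural_filtration S) (schedule N D S m k).
Proof.
move=> mD; elim: k => [|k IH] km; apply/stopping_timeE => nu nuN.
  rewrite (_ : mkset _ = \bigcup_(v in `I_nu.+1) (S v @^-1` D m (N - v)%N)).
    apply: natural_filtration_bigcup => v vnu.
    by apply: preimage_natural_filtration => //; apply: mD => //; exact: leq_subr.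
  apply/seteqP; split=> w /=.
    by move=> /min_time_lt[v /set_mem Dv vnu]; exists (v : nat).
  move=> [v /= vnu Dv]; apply/min_time_lt.
  by exists (Ordinal (leq_trans vnu (nuN : (nu < N.+1)%N))) => //=; rewrite inE.
rewrite (_ : mkset _ = \bigcup_(v in `I_nu.+1)
  ([set w | time_lt (schedule N D S m k w) v] `&` S v @^-1` D (m - k.+1)%N (N - v)%N)).
  apply: natural_filtration_bigcup => v vnu; apply: natural_filtrationI.
    case: v vnu => [_|v vnu].
      rewrite (_ : mkset _ = set0); first exact: sigma_algebra0.
      by apply/seteqP; split=> w //=; rewrite time_ltn0.
    rewrite ltnS in vnu.
    have /stopping_timeE/(_ v (leq_trans (ltnW vnu) nuN)) := IH (ltnW km).
    by apply: natural_filtration_homo; exact: ltnW.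
  apply: preimage_natural_filtration => //; apply: mD; last exact: leq_subr.
  by rewrite subn_gt0.
apply/seteqP; split=> w /=.
  by move=> /min_time_lt[v /andP[lt /set_mem Dv] vnu]; exists (v : nat).
move=> [v /= vnu [lt Dv]]; apply/min_time_lt.
exists (Ordinal (leq_trans vnu (nuN : (nu < N.+1)%N))) => //=.
by rewrite strictly_afterE /= lt inE.
Qed.

(** After c earlier exercises the right in line is coordinate c: its predecessor is used and it is
    not, so its search stops at v exactly when the price lies in D (m - c). *)
Lemma exercises_at_schedule v w : (v <= N)%N ->
  let i := (m - exercises_before sched v w)%N in
  exercises_at sched v w = (0 < i)%N && (S v w \in D i (N - v)%N).
Proof.
move=> vN; set c := exercises_before sched v w; rewrite /= subn_gt0.
have adm := schedule_pathwise_admissible w.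
have [cm|mc] := ltnP c m; last first.
  by have := exercises_at_rights sched v w; rewrite -/c (eqP mc) leqn0 => /eqP.
have ltE k := time_ltE v k adm.
pose vo := Ordinal (vN : (v < N.+1)%N).
have key : time_eq (schedule N D S m c w) v = (S v w \in D (m - c)%N (N - v)%N).
  have : ~~ time_lt (schedule N D S m c w) v.
    by rewrite (ltE (Ordinal cm)) /= ltnn.
  have Qv : (if c is c'.+1 then time_lt (schedule N D S m c' w) v else true) = true.
    case Ec : c cm => [|c'] // cm; rewrite (ltE (Ordinal (ltnW cm))) /= -/c Ec.
    exact: ltnSn.
  rewrite scheduleE; case: min_timeP => [u /andP[Qu Du] minu|none] /=.
    rewrite -leqNgt => vu; apply/eqP/idP => [<-//|Dv].
    by apply/eqP; rewrite eqn_leq vu andbT; apply: (minu vo); rewrite /= Qv Dv.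
  by move=> _; have := none vo; rewrite /= Qv /= => /negbTE.
rewrite -key; have [eqc|neqc] := boolP (time_eq _ _).
  apply/eqP; rewrite eqn_leq exercises_at_le1 //= /exercises_at.
  by rewrite (bigD1 (Ordinal cm)) //= eqc.
(* A coordinate exercised at v has index at least c, which would force coordinate c to be exercised
   by v; it is so neither at v nor before. *)
rewrite /exercises_at big1 // => k _; apply/eqP; rewrite eqb0; apply/negP => eqk.
have ck : (c <= k)%N by rewrite leqNgt -ltE; move: eqk; rewrite time_eqE => /andP[].
have ltk : time_lt (sched k w) v.+1 by rewrite time_ltS eqk.
have := time_lt_prefix (j := Ordinal cm) adm ck ltk.
by rewrite time_ltS (negbTE neqc) (ltE (Ordinal cm)) /= ltnn.
Qed.

End Schedule.

(** * Means over the binary tree *)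

Section BinaryTree.
Context (R : realType) (p : R).

(** The recursion peels off the last move, so one level is a conditional expectation given the path
    so far. *)
Fixpoint tree_mean (n : nat) (F : seq bool -> R) : R :=
  if n is n'.+1 then
    tree_mean n' (fun s => p * F (rcons s true) + (1 - p) * F (rcons s false))
  else F [::].

Fixpoint paths (n : nat) : seq (seq bool) :=
  if n is n'.+1 then [seq rcons s b | s <- paths n', b <- [:: true; false]]
  else [:: [::]].

Definition path_weight (s : seq bool) : R := \prod_(b <- s) (if b then p else 1 - p).

Lemma tree_meanS n F : tree_mean n.+1 F =
  tree_mean n (fun s => p * F (rcons s true) + (1 - p) * F (rcons s false)).
Proof. by []. Qed.

Lemma pathsS n : paths n.+1 = [seq rcons s b | s <- paths n, b <- [:: true; false]].
Proof. by []. Qed.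

Lemma mem_paths n s : (s \in paths n) = (size s == n).
Proof.
elim: n s => [|n IH] s; first by rewrite inE size_eq0.
rewrite pathsS.
apply/allpairsPdep/idP => [[t [b [tp _ ->]]]|].
  by rewrite size_rcons eqSS -IH.
case/lastP: s => // t b; rewrite size_rcons eqSS -IH => tp.
by exists t, b; split=> //; case: b.
Qed.

Lemma paths_uniq n : uniq (paths n).
Proof.
elim: n => // n IH; rewrite pathsS; apply: allpairs_uniq => //.
by move=> [s b] [t c] _ _ /= /rcons_inj [-> ->].
Qed.

Lemma tree_meanE n F : tree_mean n F = \sum_(s <- paths n) path_weight s * F s.
Proof.
elim: n F => [|n IH] F.
  by rewrite big_seq1 /path_weight big_nil mul1r.
rewrite pathsS [LHS]IH big_allpairs_dep; apply: eq_bigr => s _.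
rewrite big_cons big_seq1 /path_weight !big_rcons /=; ring.
Qed.

Lemma eq_tree_mean n F G : (forall s, size s = n -> F s = G s) ->
  tree_mean n F = tree_mean n G.
Proof.
move=> FG; rewrite !tree_meanE; apply: eq_big_seq => s.
by rewrite mem_paths => /eqP /FG ->.
Qed.

Hypotheses (p_gt0 : 0 < p) (p_lt1 : p < 1).

Lemma path_weight_gt0 s : 0 < path_weight s.
Proof. by apply: prodr_gt0 => -[] _ //; rewrite subr_gt0. Qed.

Lemma ler_tree_mean n F G : (forall s, size s = n -> F s <= G s) ->
  tree_mean n F <= tree_mean n G.
Proof.
move=> FG; rewrite !tree_meanE big_seq [leRHS]big_seq; apply: ler_sum => s.
by rewrite mem_paths => /eqP /FG; rewrite ler_pM2l // path_weight_gt0.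
Qed.

End BinaryTree.

(** * Up-down paths as atoms of the probability space *)

Section PathAtoms.
Context d (T : measurableType d) (R : realType) (P : probability T R).
Context (r lam S0 : R) (N : nat) (eps : 'I_N -> {RV P >-> R}).
Hypotheses (r_gt0 : 0 < r) (lam_gt1 : 1 < lam) (no_arb : lam^-1 < 1 + r < lam).
Hypothesis S0_gt0 : 0 < S0.
Hypothesis eps_indep : mutually_independent P (fun i => eps i : T -> R).
Hypothesis eps_up : forall i, P (eps i @^-1` [set 1]) = (up_prob r lam)%:E.
Hypothesis eps_down : forall i, P (eps i @^-1` [set -1]) = (1 - up_prob r lam)%:E.

Local Notation p := (up_prob r lam).
Local Notation S := (price S0 lam (fun i => eps i : T -> R)).

Lemma oner_eqN1 : (1 == -1 :> R) = false.
Proof. by rewrite gt_eqF // (lt_trans (ltrN10 R) ltr01). Qed.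

(* Paths shorter than the horizon are read as continued by down moves. *)
Definition path_sign (s : seq bool) (i : nat) : R := if nth false s i then 1 else -1.

Definition path_price (s : seq bool) (k : nat) : R :=
  S0 * lam `^ (\sum_(i < N | (i < k)%N) path_sign s i).

Definition path_atom (s : seq bool) : set T :=
  [set w | forall i, eps i w = path_sign s i].

Let lam_gt0 : 0 < lam. Proof. exact: lt_trans ltr01 lam_gt1. Qed.

Lemma price_atom s w k : path_atom s w -> S k w = path_price s k.
Proof.
by move=> sw; congr (_ * _ `^ _); apply: eq_bigr => i _; exact: sw.
Qed.

Lemma path_price_rcons s b k : (k <= size s)%N ->
  path_price (rcons s b) k = path_price s k.
Proof.
move=> ks; congr (_ * _ `^ _); apply: eq_bigr => i ik.
by rewrite /path_sign nth_rcons (leq_trans ik ks).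
Qed.

Lemma path_price_rconsS s b : (size s < N)%N ->
  path_price (rcons s b) (size s).+1 =
  (if b then lam else lam^-1) * path_price s (size s).
Proof.
move=> sN; rewrite -(path_price_rcons b (leqnn _)) /path_price.
rewrite (bigD1 (Ordinal sN)) //= powRD; last by rewrite (gt_eqF lam_gt0) implybT.
rewrite (_ : path_sign _ (size s) = if b then 1 else -1); last first.
  by rewrite /path_sign nth_rcons ltnn eqxx.
rewrite (eq_bigl (fun i : 'I_N => (i < size s)%N)); last first.
  by move=> i; rewrite ltnS -val_eqE /= andbC ltn_neqAle.
rewrite (_ : lam `^ _ = if b then lam else lam^-1); first by ring.
by case: b; rewrite ?powRr1 ?powR_inv1 // ltW.
Qed.

Lemma measurable_price k : measurable_fun setT (S k).
Proof.
apply: measurable_funM; first exact: measurable_cst.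
apply: measurableT_comp; first exact: measurable_powRr.
rewrite (_ : (fun w => \sum_(i < N | (i < k)%N) eps i w) =
    fun w => \sum_(i < N) (if (i < k)%N then eps i w else 0)).
  by apply: measurable_sum => i; case: (i < k)%N; [exact: measurable_funP|].
by apply/funext => w; rewrite big_mkcond.
Qed.

Lemma path_atomE s :
  path_atom s = \bigcap_(i in [set` [set: 'I_N]%SET]) eps i @^-1` [set path_sign s i].
Proof.
apply/seteqP; split=> w /=; first by move=> sw i _; exact: sw.
by move=> sw i; apply: sw; rewrite /= inE.
Qed.

Lemma path_atom_measurable s : measurable (path_atom s).
Proof.
rewrite path_atomE; apply: fin_bigcap_measurable => [|i _]; first exact: finite_finset.
by rewrite -[X in measurable X]setTI; exact: measurable_funP.
Qed.

Lemma path_atom_prob s : size s = N -> P (path_atom s) = (path_weight p s)%:E.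
Proof.
move=> sN; rewrite path_atomE eps_indep; last by move=> i; exact: measurable_set1.
rewrite /path_weight (big_nth false) big_mkord sN -prodEFin.
rewrite big_mkcond /=; under eq_bigr do rewrite inE.
by apply: eq_bigr => i _; rewrite /path_sign; case: nth.
Qed.

Lemma path_atom_nonempty s : size s = N -> exists w, path_atom s w.
Proof.
move=> sN; apply: contrapT => ne.
have E : path_atom s = set0 by apply/seteqP; split=> w // sw; case: ne; exists w.
have := path_atom_prob sN; rewrite E measure0 => /esym/eqP; rewrite eqe => /eqP h.
have := path_weight_gt0 (up_prob_gt0 no_arb) (up_prob_lt1 no_arb) s.
by rewrite h ltxx.
Qed.

Lemma price_inj k w s : S k w = path_price s k ->
  \sum_(i < N | (i < k)%N) eps i w = \sum_(i < N | (i < k)%N) path_sign s i.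
Proof.
move=> /(mulfI (lt0r_neq0 S0_gt0)) /(congr1 (@ln R)); rewrite !ln_powR.
by apply: mulIf; rewrite gt_eqF // ln_gt0.
Qed.

(** Prices determine moves: [lam] > 1 lets the logarithm recover the partial sums, and consecutive
    ones differ by a single sign. Hence atoms lie in the price filtration. *)
Lemma path_atom_price s :
  path_atom s = \bigcap_(k in `I_N.+1) (S k @^-1` [set path_price s k]).
Proof.
apply/seteqP; split=> w /=; first by move=> sw k _; exact: price_atom.
move=> sw i.
have Sp (x : 'I_N -> R) : \sum_(j < N | (j < i.+1)%N) x j =
    x i + \sum_(j < N | (j < i)%N) x j.
  rewrite (bigD1 i) //=; congr (_ + _); apply: eq_bigl => j.
  by rewrite ltnS -val_eqE /= andbC ltn_neqAle.
have h1 := price_inj (sw i.+1 (ltn_ord i)).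
have h0 := price_inj (sw i (leqW (ltn_ord i))).
by move: h1; rewrite !Sp h0 => /addIr.
Qed.

Lemma path_atom_filtration s : natural_filtration S N (path_atom s).
Proof.
rewrite path_atom_price; apply: natural_filtration_bigcap => k kN.
by apply: preimage_natural_filtration => //; exact: measurable_set1.
Qed.

Lemma path_atom_disjoint s t w : size s = N -> size t = N ->
  path_atom s w -> path_atom t w -> s = t.
Proof.
move=> sN tN sw tw; apply: (@eq_from_nth _ false) => [|i]; first by rewrite sN tN.
rewrite sN => iN; have := sw (Ordinal iN); rewrite (tw (Ordinal iN)) /path_sign /=.
by case: (nth _ s) (nth _ t) => -[] // /eqP; rewrite ?(eq_sym (-1)) oner_eqN1.
Qed.

(** The masses at 1 and -1 add up to 1, so each of the finitely many steps takes other values only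
    on a null set. *)
Lemma ae_path_atom : {ae P, forall w, exists2 s, size s = N & path_atom s w}.
Proof.
have signs : {ae P, forall w (i : 'I_N), eps i w = 1 \/ eps i w = -1}.
  apply: filter_forall => i.
  pose U := eps i @^-1` [set 1]; pose L := eps i @^-1` [set -1].
  have mU : measurable U by rewrite -[X in measurable X]setTI; exact: measurable_funP.
  have mL : measurable L by rewrite -[X in measurable X]setTI; exact: measurable_funP.
  exists (~` (U `|` L)); split.
  - by apply: measurableC; exact: measurableU.
  - rewrite probability_setC; last exact: measurableU.
    rewrite measureU //; last first.
      apply/seteqP; split=> w //= -[]; rewrite /U /L /= => -> /eqP.
      by rewrite oner_eqN1.
    transitivity (1 - (p%:E + (1 - p)%:E))%E.
      by congr (_ - (_ + _))%E; [exact: eps_up|exact: eps_down].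
    by rewrite -EFinD (addrC p) subrK subrr.
  - by move=> w /= h [] e; apply: h; [left|right].
apply: filterS signs => w sg.
exists [seq eps i w == 1 | i <- enum 'I_N]; first by rewrite size_map size_enum_ord.
move=> i; rewrite /path_sign (nth_map i) ?size_enum_ord // nth_ord_enum.
by have [e|e] := sg i; rewrite e ?eqxx // eq_sym oner_eqN1.
Qed.

End PathAtoms.

(** * Integrals of nonnegative simple functions *)

Section SimpleIntegral.
Context d (T : measurableType d) (R : realType) (P : probability T R).

Lemma integral_sum_indic (I : Type) (l : seq I) (c : I -> R) (A : I -> set T) :
  (forall i, 0 <= c i) -> (forall i, measurable (A i)) ->
  (\int[P]_w (\sum_(i <- l) c i * \1_(A i) w)%:E =
   (\sum_(i <- l) c i * fine (P (A i)))%:E)%E.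
Proof.
move=> c0 mA.
under eq_integral do rewrite -sumEFin.
rewrite ge0_integral_sum //; first last.
- by move=> i w _; rewrite lee_fin mulr_ge0.
- by move=> i; apply/measurable_EFinP; exact: measurable_funM.
rewrite -sumEFin; apply: eq_bigr => i _.
under eq_integral do rewrite EFinM.
rewrite ge0_integralZl_EFin //; last by apply/measurable_EFinP; exact: measurable_indic.
by rewrite integral_indic // setIT EFinM fineK // fin_num_measure.
Qed.

End SimpleIntegral.

(** * The expected payoff as a tree mean *)

Section PayoffIntegral.
Context d (T : measurableType d) (R : realType) (P : probability T R).
Context (r lam K S0 : R) (N : nat) (eps : 'I_N -> {RV P >-> R}).
Context (maturity : {RV P >-> nat}).
Hypotheses (r_gt0 : 0 < r) (lam_gt1 : 1 < lam) (no_arb : lam^-1 < 1 + r < lam).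
Hypothesis S0_gt0 : 0 < S0.
Hypothesis eps_indep : mutually_independent P (fun i => eps i : T -> R).
Hypothesis eps_up : forall i, P (eps i @^-1` [set 1]) = (up_prob r lam)%:E.
Hypothesis eps_down : forall i, P (eps i @^-1` [set -1]) = (1 - up_prob r lam)%:E.
Local Notation p := (up_prob r lam).
Local Notation S := (price S0 lam (fun i => eps i : T -> R)).
Hypothesis maturity_indep :
  independent_systems P (g_sigma_algebra_preimage maturity) (natural_filtration S N).
Hypothesis maturity_N : (0 < P (maturity @^-1` [set N]))%E.

Definition reach_prob (v : nat) : R := fine (P [set w | (v <= maturity w)%N]).

Let mge := @measurable_maturity_ge d T R P maturity.

Lemma reach_prob_ge0 v : 0 <= reach_prob v.
Proof. exact: fine_ge0. Qed.

Lemma reach_prob0 : reach_prob 0 = 1.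
Proof.
by rewrite /reach_prob (_ : mkset _ = setT) ?probability_setT //; apply/seteqP; split.
Qed.

Lemma reach_prob_gt0 v : (v <= N)%N -> 0 < reach_prob v.
Proof.
move=> vN; apply: fine_gt0; rewrite ltey_eq fin_num_measure ?mge // andbT.
apply: lt_le_trans maturity_N _; apply: le_measure; rewrite ?inE //.
  by rewrite -[X in measurable X]setTI; exact: measurable_funP.
by move=> w /= ->.
Qed.

(** For k = N - v - 1, [survival] conditions reaching v + 1 on reaching v; [reach_prob v] is
    positive and cancels. *)
Lemma reach_probS v : (v < N)%N ->
  reach_prob v.+1 = reach_prob v * survival P N maturity (N - v.+1).
Proof.
move=> vN; rewrite /survival /cond_prob -subSn // subSS !subKn //; last exact: ltnW.
rewrite setIidl; last by move=> w /=; exact: ltnW.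
by rewrite mulrC divfK // gt_eqF // reach_prob_gt0 // ltnW.
Qed.

Lemma path_atom_reach s v : size s = N ->
  fine (P (path_atom eps s `&` [set w | (v <= maturity w)%N])) = path_weight p s * reach_prob v.
Proof.
move=> sN; rewrite setIC maturity_indep; last exact: path_atom_filtration.
  have fa : P (path_atom eps s) \is a fin_num.
    by rewrite fin_num_measure //; exact: path_atom_measurable.
  rewrite fineM // ?fin_num_measure ?mge //.
  by rewrite (path_atom_prob eps_indep eps_up eps_down sN) mulrC.
by exists [set n | (v <= n)%N]; rewrite // setTI.
Qed.

(** A representative at which strategies are evaluated; [path_point_atom] rules out the default
    value of [get] for paths within the horizon. *)
Definition path_point (s : seq bool) : T := get (path_atom eps s).

Lemma path_atom_pad s n : path_atom eps (s ++ nseq n false) = path_atom eps s.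
Proof.
congr mkset; apply/funext => w; apply: eq_forall => i.
rewrite /path_sign nth_cat nth_nseq; case: ltnP => // si.
by rewrite (nth_default _ si) if_same.
Qed.

Lemma path_point_atom s : (size s <= N)%N -> path_atom eps s (path_point s).
Proof.
move=> sN; apply: getPex; rewrite -(path_atom_pad s (N - size s)).
by apply: (path_atom_nonempty no_arb eps_indep eps_up eps_down); rewrite size_cat size_nseq subnKC.
Qed.

Lemma price_path_point s k : (size s <= N)%N ->
  S k (path_point s) = path_price lam S0 N s k.
Proof. by move=> sN; exact: price_atom (path_point_atom sN). Qed.

Section Strategy.
Context (m : nat) (sigma : 'I_m -> T -> time N).
Hypothesis st : forall k, stopping_time (natural_filtration S) (sigma k).

Lemma measurable_payoff :
  measurable_fun setT (fun w => \sum_(k < m) right_payoff maturity r K S (sigma k) w).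
Proof.
under eq_fun do rewrite sum_right_payoffE.
apply: measurable_sum => v; apply: measurable_funM.
  rewrite (_ : (fun w => _) = fun w => \sum_(k < m) \1_[set w | time_eq (sigma k w) v] w).
    apply: measurable_sum => k; apply: measurable_indic.
    by apply: stopping_time_measurable (st k) _; [exact: measurable_price|exact: leq_ord].
  apply/funext => w; rewrite natr_sum; apply: eq_bigr => k _.
  by rewrite indicE mem_setE.
apply: measurable_funM; last first.
  apply: measurable_maxr; last exact: measurable_cst.
  by apply: measurable_funB; [exact: measurable_cst|exact: measurable_price].
apply: measurable_funM; first exact: measurable_cst.
rewrite (_ : (fun w => _) = \1_[set w | (v <= maturity w)%N]).
  exact: measurable_indic.
by apply/funext => w; rewrite indicE mem_setE.
Qed.

(** Almost every w lies on one atom, where prices and counts are constant. The payoff is thus a.e. a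
    combination of indicators of atoms cut with v <= maturity, whose probabilities factor by
    independence. *)
Lemma expected_payoffE :
  expected_payoff P maturity r K S sigma =
  (tree_mean p N (fun s => \sum_(v < N.+1) (exercises_at sigma v (path_point s))%:R *
     (discount r ^+ v * reach_prob v * put K (path_price lam S0 N s v))))%:E.
Proof.
rewrite /expected_payoff unlock.
pose c (sv : seq bool * 'I_N.+1) := (exercises_at sigma sv.2 (path_point sv.1))%:R *
  (discount r ^+ sv.2 * put K (path_price lam S0 N sv.1 sv.2)).
pose A (sv : seq bool * 'I_N.+1) :=
  path_atom eps sv.1 `&` [set w | (sv.2 <= maturity w)%N].
pose l := [seq (s, v) | s <- paths N, v <- enum 'I_N.+1].
have mA i : measurable (A i).
  by apply: measurableI; [exact: path_atom_measurable|exact: mge].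
have c0 i : 0 <= c i.
  by rewrite mulr_ge0 // mulr_ge0 ?put_ge0 // exprn_ge0 // ltW // discount_gt0.
transitivity (\int[P]_w (\sum_(i <- l) c i * \1_(A i) w)%:E)%E; last first.
  rewrite integral_sum_indic // tree_meanE; congr _%:E.
  rewrite big_allpairs; apply: eq_big_seq => s; rewrite mem_paths => /eqP sN.
  rewrite big_enum mulr_sumr; apply: eq_bigr => v _.
  by rewrite /c /A /= path_atom_reach //; ring.
apply: ae_eq_integral => //.
- by apply/measurable_EFinP; exact: measurable_payoff.
- apply/measurable_EFinP; apply: measurable_sum => i; apply: measurable_funM.
    exact: measurable_cst.
  exact: measurable_indic.
apply: filterS (ae_path_atom eps_up eps_down) => w [s sN sw] _; congr _%:E.
rewrite sum_right_payoffE big_allpairs (bigD1_seq s) ?paths_uniq ?mem_paths ?sN //=.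
(* Other full paths contribute nothing, their atoms being disjoint from that of s. *)
rewrite [X in _ = _ + X]big_seq_cond [X in _ = _ + X]big1 ?addr0; last first.
  move=> t /andP[]; rewrite mem_paths => /eqP tN ts; rewrite big1 // => v _.
  rewrite indicE memNset ?mulr0 // => -[tw _].
  by move: ts; rewrite (path_atom_disjoint tN sN tw sw) eqxx.
rewrite big_enum; apply: eq_bigr => v _.
have ag k : (k <= N)%N -> S k w = S k (path_point s).
  move=> _; rewrite (price_atom lam S0 _ sw).
  by rewrite price_path_point // sN.
rewrite /c /A /= (exercises_at_agree st (leqnn N) ag) ?leq_ord //.
rewrite (price_atom lam S0 _ sw) indicE.
have -> : (w \in path_atom eps s `&` [set w | (v <= maturity w)%N]) = (v <= maturity w)%N.
  by apply/idP/idP => [/set_mem[]//|vm]; rewrite inE.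
by ring.
Qed.

(** * The upper bound for admissible strategies *)

Local Notation V := (value P N maturity r lam K).
Local Notation x_ := (path_price lam S0 N).

Definition stage_gain (v : nat) (s : seq bool) : R :=
  (exercises_at sigma v (path_point s))%:R *
    (discount r ^+ v * reach_prob v * put K (x_ s v)).

Definition rights_left (v : nat) (s : seq bool) : nat :=
  (m - exercises_before sigma v (path_point s))%N.

(** The tree does not record the maturity; the weight [reach_prob v] accounts for the option being
    alive at v. *)
Definition running_value (v : nat) (s : seq bool) : R :=
  \sum_(u < v) stage_gain u s +
  reach_prob v * discount r ^+ v * V (rights_left v s) (N - v)%N (x_ s v).

Lemma running_value0 : running_value 0 [::] = V m N S0.
Proof.
rewrite /running_value big_ord0 add0r reach_prob0 expr0 !mul1r subn0.
rewrite /rights_left exercises_before0 subn0 /path_price big_pred0 ?powRr0 ?mulr1 //.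
Qed.

(** Both children agree with s in prices up to v, hence share gains and rights left; averaging their
    values gives the step operator, with the survival factor from [reach_probS]. *)
Lemma running_value_step v s : (v < N)%N -> size s = v ->
  p * running_value v.+1 (rcons s true) + (1 - p) * running_value v.+1 (rcons s false) =
  \sum_(u < v) stage_gain u s + reach_prob v * discount r ^+ v *
    ((exercises_at sigma v (path_point s))%:R * put K (x_ s v) +
     step P N maturity r lam (N - v.+1)
       (V (rights_left v s - exercises_at sigma v (path_point s))%N (N - v.+1)) (x_ s v)).
Proof.
move=> vN sv.
have ag b k : (k <= v)%N -> S k (path_point (rcons s b)) = S k (path_point s).
  move=> kv; rewrite price_path_point ?size_rcons ?sv //.
  by rewrite price_path_point ?sv ?(ltnW vN) // path_price_rcons // sv.
have gainE b u : (u <= v)%N -> stage_gain u (rcons s b) = stage_gain u s.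
  move=> uv; rewrite /stage_gain path_price_rcons ?sv //.
  by rewrite (exercises_at_agree st (ltnW vN) (ag b)).
have rightsE b : rights_left v.+1 (rcons s b) =
    (rights_left v s - exercises_at sigma v (path_point s))%N.
  rewrite /rights_left (exercises_before_agree st (ltnW vN) (ag b)) //.
  by rewrite exercises_beforeS subnDA.
have priceE b : x_ (rcons s b) v.+1 = (if b then lam else lam^-1) * x_ s v.
  by rewrite -sv path_price_rconsS // sv.
have sumE b : \sum_(u < v.+1) stage_gain u (rcons s b) =
    \sum_(u < v) stage_gain u s + stage_gain v s.
  rewrite big_ord_recr /= gainE //; congr (_ + _).
  by apply: eq_bigr => u _; apply: gainE; exact: ltnW.
rewrite /running_value !sumE !rightsE !priceE (reach_probS vN) exprS.
rewrite /step /one_step [stage_gain v s]/stage_gain; ring.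
Qed.

Definition total_gain (s : seq bool) : R := \sum_(v < N.+1) stage_gain v s.

Lemma total_gain_le s : (forall w, pathwise_admissible sigma w) ->
  total_gain s <= running_value N s.
Proof.
move=> adm; rewrite /total_gain big_ord_recr /= lerD2l subnn /stage_gain.
rewrite mulrCA [discount r ^+ N * _]mulrC ler_wpM2l //.
  by rewrite mulr_ge0 ?reach_prob_ge0 // exprn_ge0 // ltW // discount_gt0.
by apply: value0_ge; [exact: exercises_at_rights|exact: exercises_at_le1].
Qed.

Lemma tree_mean_running_value_le v : (forall w, pathwise_admissible sigma w) ->
  (v <= N)%N -> tree_mean p v (running_value v) <= V m N S0.
Proof.
move=> adm; elim: v => [_|v IH vN]; first by rewrite /= running_value0.
rewrite tree_meanS; apply: le_trans (IH (ltnW vN)).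
apply: ler_tree_mean; [exact: up_prob_gt0|exact: up_prob_lt1|] => s sv.
rewrite running_value_step // lerD2l ler_wpM2l //.
  by rewrite mulr_ge0 ?reach_prob_ge0 // exprn_ge0 // ltW // discount_gt0.
rewrite -[in leRHS](subnSK vN).
by apply: value_ge; [exact: exercises_at_rights|exact: exercises_at_le1].
Qed.

Lemma expected_payoff_le : (forall w, pathwise_admissible sigma w) ->
  (expected_payoff P maturity r K S sigma <= (V m N S0)%:E)%E.
Proof.
move=> adm; rewrite expected_payoffE lee_fin.
apply: le_trans (tree_mean_running_value_le adm (leqnn N)).
by apply: ler_tree_mean; [exact: up_prob_gt0|exact: up_prob_lt1|] => s _; exact: total_gain_le.
Qed.

End Strategy.

(** * Attainment by the threshold schedule *)

Section ScheduledExercise.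
Hypothesis K_gt0 : 0 < K.
Context (m : nat).

Local Notation V := (value P N maturity r lam K).
Local Notation D := (exercise_set P N maturity r lam K).
Local Notation sched := (fun k : 'I_m => schedule N D S m k).
Local Notation x_ := (path_price lam S0 N).

Lemma exercise_set_measurable i n : (0 < i)%N -> measurable (D i n).
Proof.
by case: i => // i _; rewrite (exercise_setE _ _ r_gt0 _ _ _ _ _).2.
Qed.

Lemma schedule_stopping (k : 'I_m) : stopping_time (natural_filtration S) (sched k).
Proof. by apply: schedule_stopping_time => // i n i0 _; exact: exercise_set_measurable. Qed.

Lemma exercises_at_path_point v s : (v <= N)%N -> (size s <= N)%N ->
  exercises_at sched v (path_point s) =
  (0 < rights_left sched v s)%N && (x_ s v \in D (rights_left sched v s) (N - v)%N).
Proof.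
move=> vN sN; rewrite exercises_at_schedule //.
by rewrite price_path_point.
Qed.

Lemma path_price_gt0 s v : 0 < x_ s v.
Proof. by rewrite mulr_gt0 // powR_gt0 // (lt_trans ltr01). Qed.

(** The schedule meets the condition of [value_eq] at every node, so each inequality of the upper
    bound becomes an equality. *)
Lemma tree_mean_running_value_schedule v : (v <= N)%N ->
  tree_mean p v (running_value sched v) = V m N S0.
Proof.
elim: v => [_|v IH vN]; first by rewrite /= running_value0.
rewrite -(IH (ltnW vN)) tree_meanS; apply: eq_tree_mean => s sv.
rewrite (running_value_step schedule_stopping) //; congr (_ + _ * _).
rewrite -[in RHS](subnSK vN) (value_eq r_gt0 lam_gt1 no_arb) ?path_price_gt0 //.
by rewrite exercises_at_path_point ?(ltnW vN) // ?sv ?(ltnW vN) // subnSK.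
Qed.

Lemma expected_payoff_schedule :
  expected_payoff P maturity r K S sched = (V m N S0)%:E.
Proof.
rewrite (expected_payoffE schedule_stopping); congr _%:E.
rewrite -(tree_mean_running_value_schedule (leqnn N)); apply: eq_tree_mean => s sN.
rewrite /running_value subnn big_ord_recr /=; congr (_ + _).
rewrite mulrCA [discount r ^+ N * _]mulrC; congr (_ * _).
apply: value0_eq; first exact: path_price_gt0.
by rewrite exercises_at_path_point ?sN // subnn.
Qed.

End ScheduledExercise.

End PayoffIntegral.

(** * Boundaries, optimality and expiry collected *)

Theorem theorem4p4 (R : realType) (d : measure_display) (T : measurableType d)
  (P : probability T R) (r lam K S0 : R) (N : nat)
  (eps : 'I_N -> {RV P >-> R}) (maturity : {RV P >-> nat})
  (r_gt0 : 0 < r) (lam_gt1 : 1 < lam) (no_arb : lam^-1 < 1 + r < lam)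
  (K_gt0 : 0 < K) (S0_gt0 : 0 < S0)
  (eps_indep : mutually_independent P (fun i => eps i : T -> R))
  (eps_up : forall i, P (eps i @^-1` [set 1]) = (up_prob r lam)%:E)
  (eps_down : forall i, P (eps i @^-1` [set -1]) = (1 - up_prob r lam)%:E)
  (maturity_le : forall w, (maturity w <= N)%N)
  (maturity_indep : independent_systems P (g_sigma_algebra_preimage maturity)
     (natural_filtration (price S0 lam (fun i => eps i : T -> R)) N))
  (maturity_N : (0 < P (maturity @^-1` [set N]))%E) :
  let S := price S0 lam (fun i => eps i : T -> R) in
  let D := exercise_set P N maturity r lam K in
  let xstar := boundary P N maturity r lam K in
  let pi := survival P N maturity in
  (forall m n : nat, (1 <= m)%N -> (n <= N)%N ->
     has_sup (D m n) /\ D m n = `]0, xstar m n]%classic) /\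
  (forall m n : nat, (1 <= m)%N -> (n <= N)%N ->
     xstar m n <= xstar m.+1 n) /\
  ((forall k : nat, (k.+1 < N)%N -> pi k <= pi k.+1) ->
   forall m n : nat, (1 <= m)%N -> (n < N)%N ->
     xstar m n.+1 <= xstar m n) /\
  (forall m : nat, (1 <= m)%N ->
     let sigmastar := fun k : 'I_m => schedule N D S m k in
     let payoff := fun sigma : 'I_m -> T -> time N =>
       expected_payoff P maturity r K S sigma in
     admissible (natural_filtration S) sigmastar /\
     payoff sigmastar =
       ereal_sup [set payoff sigma | sigma in
         [set sigma | admissible (natural_filtration S) sigma]] /\
     (forall (k : 'I_m) (w : T),
        right_payoff maturity r K S (sigmastar k) w <> 0 ->
        exists2 v, sigmastar k w = Some v & (v <= maturity w)%N) /\
     (forall (k : 'I_m) (w : T) (v : 'I_N.+1),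
        sigmastar k w = Some v -> (maturity w < v)%N ->
        forall j : 'I_m, (k <= j)%N ->
          right_payoff maturity r K S (sigmastar j) w = 0)).
Proof.
move=> S D xstar pi.
have DE m n : (1 <= m)%N -> has_sup (D m n) /\ D m n = `]0, xstar m n]%classic.
  by case: m => // m _; exact: exercise_setE.
split; first by move=> m n m1 _; exact: DE.
split; first by case=> // m n _ _; exact: boundary_incr_rights.
split.
  by move=> pi_homo [//|m] n _ nN; exact: boundary_decr_steps.
move=> m _ sigmastar payoff.
have adm w : pathwise_admissible sigmastar w := @schedule_pathwise_admissible d T R N S D m w.
have stop k : stopping_time (natural_filtration S) (sigmastar k).
  exact: schedule_stopping.
have admS : admissible (natural_filtration S) sigmastar by [].
split=> //; split.
  apply/eqP; rewrite eq_le; apply/andP; split.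
    by apply: ereal_sup_ubound; exists sigmastar.
  (* Both payoffs are compared with [value] at m rights, N steps and price [S0]. *)
  apply: ge_ereal_sup => _ [sigma [st sadm] <-].
  rewrite /payoff expected_payoff_schedule //.
  exact: expected_payoff_le.
split=> [k w|k w v Ek vlt j kj].
  rewrite /right_payoff; case: (sigmastar k w) => [v|//] nz; exists v => //.
  by apply: contrapT => /negP/negbTE vm; apply: nz; rewrite vm mulr0 mul0r.
rewrite /right_payoff; case Ej : (sigmastar j w) => [u|//].
(* Later coordinates are exercised no earlier than v, hence after the maturity. *)
suff vu : (v <= u)%N by rewrite leqNgt (leq_trans vlt vu) mulr0 mul0r.
move: kj; rewrite leq_eqVlt => /predU1P[/val_inj kj|kj].
  by move: Ej; rewrite -kj Ek => -[->].
have [l _ [_ inc]] := adm w.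
exact/ltnW/(inc k j).
Qed.
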